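(* Let $Q$ be a restriction quantal frame. Then the set $\mathsf{PI}(Q)$ of partial isometries of $Q$, with the multiplication, identity $e$ and operations $\ast,+$ inherited from $Q$, is a complete restriction monoid.
   Context: A restriction quantal frame is a frame $(Q,\le)$ with an associative multiplication distributing over arbitrary joins on both sides, which is a monoid with identity $e$ and carries join-preserving unary operations $a\mapsto a^{\ast}$, $a\mapsto a^{+}$ with values in the set $e^{\downarrow}=\{x:x\le e\}$ of projections (a commutative subsemigroup of idempotents), fixing projections, with $aa^{\ast}=a$, $a^{+}a=a$, $(ab)^{\ast}=(a^{\ast}b)^{\ast}$, $(ab)^{+}=(ab^{+})^{+}$; the top element is a join of partial isometries and partial isometries are closed under product. $a$ is a partial isometry if $b\le a$ implies $b=b^{+}a=ab^{\ast}$. An Ehresmann monoid is a monoid with such operations $\ast,+$ onto a commutative subsemigroup of idempotents satisfying the four identities above; it is a restriction monoid if in addition $fa=a(fa)^{\ast}$ and $af=(af)^{+}a$ for all projections $f$ and elements $a$. Its natural partial order is $a\le b$ iff $a=a^{+}b=ba^{\ast}$. Elements $a,b$ are compatible if $ab^{\ast}=ba^{\ast}$ and $b^{+}a=a^{+}b$. A restriction monoid is complete if every set of pairwise compatible elements has a join (in the natural partial order) and multiplication distributes over such joins. *)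

(* Defs.v *)
Section Defs.
Context {Q : Type}.

Definition img (f : Q -> Q) (A : Q -> Prop) : Q -> Prop :=
  fun y => exists a, A a /\ y = f a.

Definition is_lub (le : Q -> Q -> Prop) (A : Q -> Prop) (x : Q) : Prop :=
  (forall a, A a -> le a x) /\
  (forall y, (forall a, A a -> le a y) -> le x y).

Definition is_glb2 (le : Q -> Q -> Prop) (a b x : Q) : Prop :=
  le x a /\ le x b /\ (forall y, le y a -> le y b -> le y x).

Definition partial_order (le : Q -> Q -> Prop) : Prop :=
  (forall a, le a a) /\
  (forall a b, le a b -> le b a -> a = b) /\
  (forall a b c, le a b -> le b c -> le a c).

Definition is_frame (le : Q -> Q -> Prop) (sup : (Q -> Prop) -> Q)
    (meet : Q -> Q -> Q) : Prop :=
  partial_order le /\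
  (forall A, is_lub le A (sup A)) /\
  (forall a b, is_glb2 le a b (meet a b)) /\
  (forall a A, meet a (sup A) = sup (img (meet a) A)).

Definition partial_isometry (le : Q -> Q -> Prop) (mul : Q -> Q -> Q)
    (star plus : Q -> Q) (a : Q) : Prop :=
  forall b, le b a -> b = mul (plus b) a /\ b = mul a (star b).

Definition restriction_quantal_frame (le : Q -> Q -> Prop)
    (sup : (Q -> Prop) -> Q) (meet : Q -> Q -> Q) (mul : Q -> Q -> Q)
    (e : Q) (star plus : Q -> Q) : Prop :=
  is_frame le sup meet /\
  (forall a b c, mul a (mul b c) = mul (mul a b) c) /\
  (forall a A, mul a (sup A) = sup (img (mul a) A)) /\
  (forall a A, mul (sup A) a = sup (img (fun x => mul x a) A)) /\
  (forall a, mul e a = a) /\ (forall a, mul a e = a) /\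
  (forall f g, le f e -> le g e -> le (mul f g) e) /\
  (forall f g, le f e -> le g e -> mul f g = mul g f) /\
  (forall f, le f e -> mul f f = f) /\
  (forall A, star (sup A) = sup (img star A)) /\
  (forall A, plus (sup A) = sup (img plus A)) /\
  (forall a, le (star a) e) /\ (forall a, le (plus a) e) /\
  (forall f, le f e -> star f = f) /\ (forall f, le f e -> plus f = f) /\
  (forall a, mul a (star a) = a) /\ (forall a, mul (plus a) a = a) /\
  (forall a b, star (mul a b) = star (mul (star a) b)) /\
  (forall a b, plus (mul a b) = plus (mul a (plus b))) /\
  sup (fun _ => True) = sup (partial_isometry le mul star plus) /\
  (forall a b, partial_isometry le mul star plus a ->
     partial_isometry le mul star plus b ->
     partial_isometry le mul star plus (mul a b)).

Definition ehresmann_monoid_on (S : Q -> Prop) (mul : Q -> Q -> Q) (e : Q)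
    (star plus : Q -> Q) (E : Q -> Prop) : Prop :=
  S e /\ (forall a b, S a -> S b -> S (mul a b)) /\
  (forall a, S a -> S (star a)) /\ (forall a, S a -> S (plus a)) /\
  (forall a b c, S a -> S b -> S c -> mul a (mul b c) = mul (mul a b) c) /\
  (forall a, S a -> mul e a = a) /\ (forall a, S a -> mul a e = a) /\
  (forall f, E f -> S f) /\
  (forall f g, E f -> E g -> E (mul f g)) /\
  (forall f g, E f -> E g -> mul f g = mul g f) /\
  (forall f, E f -> mul f f = f) /\
  (forall a, S a -> E (star a)) /\ (forall a, S a -> E (plus a)) /\
  (forall f, E f -> star f = f) /\ (forall f, E f -> plus f = f) /\
  (forall a, S a -> mul a (star a) = a) /\
  (forall a, S a -> mul (plus a) a = a) /\
  (forall a b, S a -> S b -> star (mul a b) = star (mul (star a) b)) /\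
  (forall a b, S a -> S b -> plus (mul a b) = plus (mul a (plus b))).

Definition restriction_monoid_on (S : Q -> Prop) (mul : Q -> Q -> Q) (e : Q)
    (star plus : Q -> Q) : Prop :=
  exists E : Q -> Prop,
    ehresmann_monoid_on S mul e star plus E /\
    (forall f a, E f -> S a -> mul f a = mul a (star (mul f a))) /\
    (forall f a, E f -> S a -> mul a f = mul (plus (mul a f)) a).

Definition nat_le (mul : Q -> Q -> Q) (star plus : Q -> Q) (a b : Q) : Prop :=
  a = mul (plus a) b /\ a = mul b (star a).

Definition compatible (mul : Q -> Q -> Q) (star plus : Q -> Q) (a b : Q)
    : Prop :=
  mul a (star b) = mul b (star a) /\ mul (plus b) a = mul (plus a) b.

Definition is_lub_in (S : Q -> Prop) (R : Q -> Q -> Prop) (A : Q -> Prop)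
    (x : Q) : Prop :=
  S x /\ (forall a, A a -> R a x) /\
  (forall y, S y -> (forall a, A a -> R a y) -> R x y).

Definition complete_restriction_monoid_on (S : Q -> Prop)
    (mul : Q -> Q -> Q) (e : Q) (star plus : Q -> Q) : Prop :=
  restriction_monoid_on S mul e star plus /\
  forall A : Q -> Prop,
    (forall a, A a -> S a) ->
    (forall a b, A a -> A b -> compatible mul star plus a b) ->
    exists x, is_lub_in S (nat_le mul star plus) A x /\
      (forall c, S c ->
         is_lub_in S (nat_le mul star plus) (img (mul c) A) (mul c x) /\
         is_lub_in S (nat_le mul star plus) (img (fun a => mul a c) A)
                   (mul x c)).

End Defs.

(* Main.v *)
Require Import Defs.
From Stdlib Require Import Setoid.

(* First, every join-preserving map (left and right multiplication, star, plus)
   is monotone, and multiplying by a projection f <= e moves an element down.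
   This already makes the projections partial isometries and gives the
   restriction-monoid identities f a = a (f a)^* and a f = (a f)^+ a for free:
   f a and a f lie below the partial isometry a.
   The heart of the proof is that the join x = sup A of a pairwise compatible
   family A of partial isometries is again a partial isometry: an element
   b <= x is the join of the meets b /\ a (frame distributivity), each of
   which is cut out of a by its own support, and compatibility lets the
   support (b /\ a)^+ restrict every other a' in A to something below a.
   Finally, the natural order is contained in the frame order and agrees with
   it below a partial isometry, so sup A is the natural join of A; joins of
   the families c A and A c are c x and x c by distributivity. *)

Section PartialIsometries.

Variable Q : Type.
Variable le : Q -> Q -> Prop.
Variable sup : (Q -> Prop) -> Q.
Variable meet : Q -> Q -> Q.
Variables (mul : Q -> Q -> Q) (e : Q) (star plus : Q -> Q).

(* The axioms of a restriction quantal frame, except that the top element is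
   a join of partial isometries, which the argument does not need. *)
Hypothesis le_refl : forall a, le a a.
Hypothesis le_antisym : forall a b, le a b -> le b a -> a = b.
Hypothesis le_trans : forall a b c, le a b -> le b c -> le a c.
Hypothesis sup_lub : forall A, is_lub le A (sup A).
Hypothesis meet_glb : forall a b, is_glb2 le a b (meet a b).
Hypothesis meet_sup_distr : forall a A, meet a (sup A) = sup (img (meet a) A).

Hypothesis mul_assoc : forall a b c, mul a (mul b c) = mul (mul a b) c.
Hypothesis mul_sup_l : forall a A, mul a (sup A) = sup (img (mul a) A).
Hypothesis mul_sup_r :
  forall a A, mul (sup A) a = sup (img (fun x => mul x a) A).
Hypothesis mul_e_l : forall a, mul e a = a.
Hypothesis mul_e_r : forall a, mul a e = a.

Hypothesis proj_mul_closed :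
  forall f g, le f e -> le g e -> le (mul f g) e.
Hypothesis proj_mul_comm : forall f g, le f e -> le g e -> mul f g = mul g f.
Hypothesis proj_idem : forall f, le f e -> mul f f = f.

Hypothesis star_sup : forall A, star (sup A) = sup (img star A).
Hypothesis plus_sup : forall A, plus (sup A) = sup (img plus A).
Hypothesis star_le_e : forall a, le (star a) e.
Hypothesis plus_le_e : forall a, le (plus a) e.
Hypothesis star_proj : forall f, le f e -> star f = f.
Hypothesis plus_proj : forall f, le f e -> plus f = f.
Hypothesis mul_star : forall a, mul a (star a) = a.
Hypothesis plus_mul : forall a, mul (plus a) a = a.
Hypothesis star_mul : forall a b, star (mul a b) = star (mul (star a) b).
Hypothesis plus_mul_plus : forall a b, plus (mul a b) = plus (mul a (plus b)).

Hypothesis PI_mul : forall a b,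
  partial_isometry le mul star plus a -> partial_isometry le mul star plus b ->
  partial_isometry le mul star plus (mul a b).

Local Notation PI := (partial_isometry le mul star plus).

Lemma sup_upper (A : Q -> Prop) (a : Q) : A a -> le a (sup A).
Proof. exact (proj1 (sup_lub A) a). Qed.

Lemma sup_least (A : Q -> Prop) (y : Q) :
  (forall a, A a -> le a y) -> le (sup A) y.
Proof. exact (proj2 (sup_lub A) y). Qed.

(* A join-preserving map is monotone: b is the join of {a, b} when a <= b. *)
Lemma join_preserving_monotone (f : Q -> Q) :
  (forall A, f (sup A) = sup (img f A)) ->
  forall a b, le a b -> le (f a) (f b).
Proof.
  intros f_sup a b Hab.
  assert (Hpair : sup (fun z => z = a \/ z = b) = b).
  { apply le_antisym.
    - apply sup_least. intros z [-> | ->]; auto.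
    - apply sup_upper. auto. }
  rewrite <- Hpair, f_sup. apply sup_upper. exists a. auto.
Qed.

Lemma mul_left_monotone (c a b : Q) : le a b -> le (mul c a) (mul c b).
Proof. apply join_preserving_monotone, mul_sup_l. Qed.

Lemma mul_right_monotone (c a b : Q) : le a b -> le (mul a c) (mul b c).
Proof. apply (join_preserving_monotone (fun x => mul x c)), mul_sup_r. Qed.

Lemma mul_monotone (a a' b b' : Q) :
  le a a' -> le b b' -> le (mul a b) (mul a' b').
Proof.
  intros Ha Hb. apply le_trans with (mul a' b).
  - apply mul_right_monotone, Ha.
  - apply mul_left_monotone, Hb.
Qed.

Lemma star_monotone (a b : Q) : le a b -> le (star a) (star b).
Proof. apply join_preserving_monotone, star_sup. Qed.

Lemma plus_monotone (a b : Q) : le a b -> le (plus a) (plus b).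
Proof. apply join_preserving_monotone, plus_sup. Qed.

Lemma proj_restrict_l (f a : Q) : le f e -> le (mul f a) a.
Proof.
  intros Hf. rewrite <- (mul_e_l a) at 2. apply mul_right_monotone, Hf.
Qed.

Lemma proj_restrict_r (f a : Q) : le f e -> le (mul a f) a.
Proof.
  intros Hf. rewrite <- (mul_e_r a) at 2. apply mul_left_monotone, Hf.
Qed.

Lemma proj_absorb_r (b f : Q) : le b f -> le f e -> mul b f = b.
Proof.
  intros Hbf Hf. apply le_antisym.
  - apply proj_restrict_r, Hf.
  - rewrite <- (proj_idem b (le_trans _ _ _ Hbf Hf)) at 1.
    apply mul_left_monotone, Hbf.
Qed.

Lemma proj_absorb_l (b f : Q) : le b f -> le f e -> mul f b = b.
Proof.
  intros Hbf Hf. rewrite proj_mul_comm by eauto. apply proj_absorb_r; auto.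
Qed.

Lemma proj_is_PI (f : Q) : le f e -> PI f.
Proof.
  intros Hf b Hb. assert (Hbe : le b e) by eauto.
  rewrite (plus_proj b Hbe), (star_proj b Hbe).
  split; symmetry; [apply proj_absorb_r | apply proj_absorb_l]; assumption.
Qed.

Lemma PI_restriction_monoid : restriction_monoid_on PI mul e star plus.
Proof.
  exists (fun f => le f e). split; [| split].
  - unfold ehresmann_monoid_on.
    repeat match goal with |- _ /\ _ => split end;
      intros; auto using proj_is_PI.
  - intros f a Hf Ha. apply (Ha (mul f a)), proj_restrict_l, Hf.
  - intros f a Hf Ha. apply (Ha (mul a f)), proj_restrict_r, Hf.
Qed.

Lemma nat_le_le (a b : Q) : nat_le mul star plus a b -> le a b.
Proof. intros [Ha _]. rewrite Ha. apply proj_restrict_l, plus_le_e. Qed.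

Lemma PI_sup_is_nat_lub (B : Q -> Prop) :
  PI (sup B) -> is_lub_in PI (nat_le mul star plus) B (sup B).
Proof.
  intros HB. split; [exact HB | split].
  - intros a Ha. apply HB, sup_upper, Ha.
  - intros y Hy Hub. apply Hy, sup_least.
    intros a Ha. apply nat_le_le, Hub, Ha.
Qed.

(* Frame distributivity: b below a join is the join of its meets with the
   members of the family. *)
Lemma below_sup_meets (b : Q) (A : Q -> Prop) :
  le b (sup A) -> b = sup (img (meet b) A).
Proof.
  intros Hb. rewrite <- meet_sup_distr.
  destruct (meet_glb b (sup A)) as (Hl & _ & Hgreatest).
  apply le_antisym; auto.
Qed.

Lemma compatible_restrict_plus (a a' f : Q) :
  compatible mul star plus a' a -> le f (plus a) ->
  le (mul f a') (mul f a).
Proof.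
  intros [_ Hplus] Hf.
  assert (E : mul f a' = mul f (mul (plus a') a)).
  { rewrite <- Hplus, mul_assoc, (proj_absorb_r f (plus a)); auto. }
  rewrite E. apply mul_left_monotone, proj_restrict_l, plus_le_e.
Qed.

Lemma compatible_restrict_star (a a' g : Q) :
  compatible mul star plus a' a -> le g (star a) ->
  le (mul a' g) (mul a g).
Proof.
  intros [Hstar _] Hg.
  assert (E : mul a' g = mul (mul a (star a')) g).
  { rewrite <- Hstar, <- mul_assoc, (proj_absorb_l g (star a)); auto. }
  rewrite E, <- mul_assoc. apply mul_left_monotone, proj_restrict_l, star_le_e.
Qed.

Section CompatibleFamily.

Variable A : Q -> Prop.
Hypothesis A_PI : forall a, A a -> PI a.
Hypothesis A_compatible :
  forall a b, A a -> A b -> compatible mul star plus a b.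

Lemma meet_part_plus (b a : Q) :
  A a -> meet b a = mul (plus (meet b a)) a.
Proof.
  intros Ha. apply (A_PI a Ha), (proj1 (proj2 (meet_glb b a))).
Qed.

Lemma meet_part_star (b a : Q) :
  A a -> meet b a = mul a (star (meet b a)).
Proof.
  intros Ha. apply (A_PI a Ha), (proj1 (proj2 (meet_glb b a))).
Qed.

Lemma below_compatible_sup_plus (b : Q) :
  le b (sup A) -> b = mul (plus b) (sup A).
Proof.
  intros Hb. pose proof (below_sup_meets b A Hb) as Eb.
  apply le_antisym.
  - rewrite Eb at 1. apply sup_least. intros y (a & Ha & ->).
    rewrite (meet_part_plus b a Ha) at 1. apply mul_monotone.
    + apply plus_monotone, (meet_glb b a).
    + apply sup_upper, Ha.
  - assert (Ep : plus b = sup (img plus (img (meet b) A))).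
    { rewrite <- plus_sup, <- Eb. reflexivity. }
    rewrite Ep, mul_sup_r. apply sup_least.
    intros y (p & (q & (a & Ha & ->) & ->) & ->).
    rewrite mul_sup_l. apply sup_least. intros z (a' & Ha' & ->).
    apply le_trans with (mul (plus (meet b a)) a).
    + apply compatible_restrict_plus; auto.
      apply plus_monotone, (meet_glb b a).
    + rewrite <- (meet_part_plus b a Ha). apply (meet_glb b a).
Qed.

Lemma below_compatible_sup_star (b : Q) :
  le b (sup A) -> b = mul (sup A) (star b).
Proof.
  intros Hb. pose proof (below_sup_meets b A Hb) as Eb.
  apply le_antisym.
  - rewrite Eb at 1. apply sup_least. intros y (a & Ha & ->).
    rewrite (meet_part_star b a Ha) at 1. apply mul_monotone.
    + apply sup_upper, Ha.
    + apply star_monotone, (meet_glb b a).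
  - assert (Es : star b = sup (img star (img (meet b) A))).
    { rewrite <- star_sup, <- Eb. reflexivity. }
    rewrite Es, mul_sup_l. apply sup_least.
    intros y (p & (q & (a & Ha & ->) & ->) & ->).
    rewrite mul_sup_r. apply sup_least. intros z (a' & Ha' & ->).
    apply le_trans with (mul a (star (meet b a))).
    + apply compatible_restrict_star; auto.
      apply star_monotone, (meet_glb b a).
    + rewrite <- (meet_part_star b a Ha). apply (meet_glb b a).
Qed.

Lemma compatible_sup_PI : PI (sup A).
Proof.
  intros b Hb. split.
  - apply below_compatible_sup_plus, Hb.
  - apply below_compatible_sup_star, Hb.
Qed.

Lemma compatible_sup_nat_lub :
  is_lub_in PI (nat_le mul star plus) A (sup A) /\
  (forall c, PI c ->
     is_lub_in PI (nat_le mul star plus) (img (mul c) A) (mul c (sup A)) /\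
     is_lub_in PI (nat_le mul star plus) (img (fun a => mul a c) A)
               (mul (sup A) c)).
Proof.
  split; [apply PI_sup_is_nat_lub, compatible_sup_PI |].
  intros c Hc. split.
  - rewrite mul_sup_l. apply PI_sup_is_nat_lub.
    rewrite <- mul_sup_l. apply PI_mul; [exact Hc | apply compatible_sup_PI].
  - rewrite mul_sup_r. apply PI_sup_is_nat_lub.
    rewrite <- mul_sup_r. apply PI_mul; [apply compatible_sup_PI | exact Hc].
Qed.

End CompatibleFamily.

Lemma PI_complete_restriction_monoid :
  complete_restriction_monoid_on PI mul e star plus.
Proof.
  split; [exact PI_restriction_monoid |].
  intros A HA Hc. exists (sup A). apply compatible_sup_nat_lub; assumption.
Qed.

End PartialIsometries.

Theorem mainTheorem6 (Q : Type) (le : Q -> Q -> Prop)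
    (sup : (Q -> Prop) -> Q) (meet : Q -> Q -> Q) (mul : Q -> Q -> Q)
    (e : Q) (star plus : Q -> Q) :
  restriction_quantal_frame le sup meet mul e star plus ->
  complete_restriction_monoid_on (partial_isometry le mul star plus)
    mul e star plus.
Proof.
  intros (Hframe & Hassoc & Hmul_sup_l & Hmul_sup_r & Hel & Her & Hproj_mul
    & Hproj_comm & Hproj_idem & Hstar_sup & Hplus_sup & Hstar_e & Hplus_e
    & Hstar_proj & Hplus_proj & Hmul_star & Hplus_mul & Hstar_mul
    & Hplus_mul_plus & _ & HPI_mul).
  destruct Hframe as ((Hrefl & Hanti & Htrans) & Hlub & Hglb & Hmeet_sup).
  apply (PI_complete_restriction_monoid Q le sup meet mul e star plus);
    assumption.
Qed.
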